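(* For a parameter $t$ set $$\varphi_{12}(x)=-\frac{t^2(10t^2+25t+16)}{16(3t+4)^7}\cdot\frac{F_{12}(x)^3\,G_{12}(x)}{H_{12}(x)^5},$$ where $$F_{12}=2tx^3+14tx^2-2(2t+5)(15t^2+25t+16)x-(2t+5)(5t+16)(5t^2+10t+6),$$ $$\begin{aligned}G_{12}={}&50t(10t^2+25t+16)x^3-30t(14t^3-18t^2-105t-80)x^2\\&-6(5t+16)(2t+1)(20t^3+35t^2+3t-16)x-(2t+1)^2(5t+16)^2(5t^2+10t+6),\end{aligned}$$ $$H_{12}=3tx^2+12tx+(2t+1)(5t+16).$$ Then $$1-\varphi_{12}(x)=\frac{1}{16(3t+4)^7}\cdot\frac{P_{12}(x)^2}{H_{12}(x)^5},$$ where $$\begin{aligned} P_{12}={}&20t^3(10t^2+25t+16)x^6-12t^3(7t^3-184t^2-490t-320)x^5\\ &+60t^2(200t^5+1386t^4+4068t^3+5885t^2+4048t+1024)x^4\\ &+20t^2(250t^6+6415t^5+37627t^4+100300t^3+137092t^2+92992t+24576)x^3\\ &-60t(5t+16)(200t^7+1260t^6+3052t^5+3248t^4+1126t^3-137t^2+256t+256)x^2\\ &-30t(5t+16)^2(100t^7+740t^6+2289t^5+3780t^4+3600t^3+2040t^2+700t+128)x\\ &-(2t+1)(5t+16)^3(100t^7+740t^6+2289t^5+3780t^4+3600t^3+2040t^2+700t+128). \end{aligned}$$ Moreover, for generic $t$ (all but finitely many $t\in\mathbb{C}$), $\varphi_{12}:\mathbb{P}^1_x\to\mathbb{P}^1_z$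 is an almost Belyi covering of degree $12$ with ramification pattern $$R_4\big(3+3+3+1+1+1\,|\,2+2+2+2+2+2\,|\,5+5+2\big),$$ the point of ramification order $2$ above $z=\infty$ being $x=\infty$, and the extra ramification point being $x=0$.
   Context: An almost Belyi covering is a rational map $\varphi:\mathbb{P}^1_x\to\mathbb{P}^1_z$ such that all its ramified points, except exactly one simply ramified point (ramification order $2$), lie above $\{0,1,\infty\}\subset\mathbb{P}^1_z$; the exceptional point lies above a fourth point of $\mathbb{P}^1_z\setminus\{0,1,\infty\}$ and is called the extra ramification point. For partitions $P_1,P_2,P_3$ of $n$, an almost Belyi covering of degree $n$ has ramification pattern $R_4(P_1\,|\,P_2\,|\,P_3)$ if the ramification orders of the points above $z=0$, $z=1$, $z=\infty$ are given, respectively, by $P_1,P_2,P_3$ (the fourth ramified fiber then has pattern $2+1+\cdots+1$). *)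

(* Defs.v *)
From HB Require Import structures.
From mathcomp Require Import all_boot all_order all_algebra.
From mathcomp Require Import generic_quotient fraction.
From mathcomp Require Import reals complex.

Set Implicit Arguments.
Unset Strict Implicit.
Unset Printing Implicit Defensive.

Import Order.TTheory GRing.Theory Num.Theory.
Local Open Scope ring_scope.

(* Points of the projective line: Some a is the point x = a, and None is the
   point x = oo.  Rational maps are elements of {fraction {poly K}}.  Fibers
   only involve K-points, so the notions below have their usual geometric
   meaning when K is algebraically closed. *)
Notation P1 K := (option K).
Notation "x %:F" := (@FracField.tofrac _ x) : ring_scope.

(* Coprime numerator and denominator, unique up to a common scalar. *)
Definition rat_num (K : fieldType) (f : {fraction {poly K}}) : {poly K} :=
  let r := repr f in \n_r %/ gcdp \n_r \d_r.

Definition rat_den (K : fieldType) (f : {fraction {poly K}}) : {poly K} :=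
  let r := repr f in \d_r %/ gcdp \n_r \d_r.

Definition rat_degree (K : fieldType) (f : {fraction {poly K}}) : nat :=
  (maxn (size (rat_num f)) (size (rat_den f))).-1.

Definition rat_eval (K : fieldType) (f : {fraction {poly K}}) (p : P1 K)
    : P1 K :=
  match p with
  | Some a => if (rat_den f).[a] == 0 then None
              else Some ((rat_num f).[a] / (rat_den f).[a])
  | None => if (size (rat_den f) < size (rat_num f))%N then None
            else Some ((rat_num f)`_(size (rat_den f)).-1
                       / lead_coef (rat_den f))
  end.

(* Order of vanishing of f <> 0 at p, negative at poles. *)
Definition rat_ord (K : fieldType) (f : {fraction {poly K}}) (p : P1 K)
    : int :=
  match p with
  | Some a => (mup a (rat_num f))%:Z - (mup a (rat_den f))%:Z
  | None => (size (rat_den f))%:Z - (size (rat_num f))%:Z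
  end.

(* Order of vanishing at p of (z - c) o f, where c = f p, or of (1 / z) o f
   when f p = oo.  For nonconstant f this order is positive, so that the
   absolute value is only a conversion to nat. *)
Definition ram_order (K : fieldType) (f : {fraction {poly K}}) (p : P1 K)
    : nat :=
  match rat_eval f p with
  | Some c => absz (rat_ord (f - (c%:P)%:F) p)
  | None => absz (rat_ord f^-1 p)
  end.

Definition fiber_pattern (K : fieldType) (f : {fraction {poly K}}) (c : P1 K)
    (P : seq nat) : Prop :=
  exists s : seq (P1 K),
    [/\ uniq s,
        forall p : P1 K, (p \in s) = (rat_eval f p == c)
      & perm_eq [seq ram_order f p | p <- s] P].

(* The last clause makes q the only ramified point that is not above
   {0, 1, oo}. *)
Definition extra_ram_point (K : fieldType) (f : {fraction {poly K}})
    (q : P1 K) : Prop :=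
  [/\ rat_eval f q \notin [:: Some 0; Some 1; None],
      ram_order f q = 2%N
    & forall p : P1 K, (1 < ram_order f p)%N -> p != q ->
        rat_eval f p \in [:: Some 0; Some 1; None]].

Definition almost_belyi (K : fieldType) (f : {fraction {poly K}}) : Prop :=
  (0 < rat_degree f)%N /\ exists q : P1 K, extra_ram_point f q.

Definition is_partition (n : nat) (P : seq nat) : bool :=
  (sumn P == n) && (0%N \notin P).

Definition almost_belyi_R4 (K : fieldType) (f : {fraction {poly K}}) (n : nat)
    (A B C : seq nat) : Prop :=
  [/\ almost_belyi f,
      rat_degree f = n,
      [&& is_partition n A, is_partition n B & is_partition n C]
    & [/\ fiber_pattern f (Some 0) A,
          fiber_pattern f (Some 1) B
        & fiber_pattern f None C]].

Definition F12 (K : fieldType) (t : K) : {poly K} :=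
  (2 * t) *: 'X^3 + (14 * t) *: 'X^2
  - (2 * (2 * t + 5) * (15 * t ^+ 2 + 25 * t + 16)) *: 'X
  - ((2 * t + 5) * (5 * t + 16) * (5 * t ^+ 2 + 10 * t + 6))%:P.

Definition G12 (K : fieldType) (t : K) : {poly K} :=
  (50 * t * (10 * t ^+ 2 + 25 * t + 16)) *: 'X^3
  - (30 * t * (14 * t ^+ 3 - 18 * t ^+ 2 - 105 * t - 80)) *: 'X^2
  - (6 * (5 * t + 16) * (2 * t + 1)
     * (20 * t ^+ 3 + 35 * t ^+ 2 + 3 * t - 16)) *: 'X
  - ((2 * t + 1) ^+ 2 * (5 * t + 16) ^+ 2 * (5 * t ^+ 2 + 10 * t + 6))%:P.

Definition H12 (K : fieldType) (t : K) : {poly K} :=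
  (3 * t) *: 'X^2 + (12 * t) *: 'X + ((2 * t + 1) * (5 * t + 16))%:P.

(* The numerals above 5000 are cast from nat: direct ring_scope parsing of
   them overflows the stack. *)
Definition P12 (K : fieldType) (t : K) : {poly K} :=
  (20 * t ^+ 3 * (10 * t ^+ 2 + 25 * t + 16)) *: 'X^6
  - (12 * t ^+ 3 * (7 * t ^+ 3 - 184 * t ^+ 2 - 490 * t - 320)) *: 'X^5
  + (60 * t ^+ 2 * (200 * t ^+ 5 + 1386 * t ^+ 4 + 4068 * t ^+ 3
                    + 5885%:R * t ^+ 2 + 4048 * t + 1024)) *: 'X^4
  + (20 * t ^+ 2 * (250 * t ^+ 6 + 6415%:R * t ^+ 5 + 37627%:R * t ^+ 4
                    + 100300%:R * t ^+ 3 + 137092%:R * t ^+ 2 + 92992%:R * t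
                    + 24576%:R)) *: 'X^3
  - (60 * t * (5 * t + 16)
     * (200 * t ^+ 7 + 1260 * t ^+ 6 + 3052 * t ^+ 5 + 3248 * t ^+ 4
        + 1126 * t ^+ 3 - 137 * t ^+ 2 + 256 * t + 256)) *: 'X^2
  - (30 * t * (5 * t + 16) ^+ 2
     * (100 * t ^+ 7 + 740 * t ^+ 6 + 2289 * t ^+ 5 + 3780 * t ^+ 4
        + 3600 * t ^+ 3 + 2040 * t ^+ 2 + 700 * t + 128)) *: 'X
  - ((2 * t + 1) * (5 * t + 16) ^+ 3
     * (100 * t ^+ 7 + 740 * t ^+ 6 + 2289 * t ^+ 5 + 3780 * t ^+ 4
        + 3600 * t ^+ 3 + 2040 * t ^+ 2 + 700 * t + 128))%:P.

Definition phi12 (K : fieldType) (t : K) : {fraction {poly K}} :=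
  - ((t ^+ 2 * (10 * t ^+ 2 + 25 * t + 16) / (16 * (3 * t + 4) ^+ 7))%:P)%:F
  * ((F12 t ^+ 3 * G12 t)%:F / (H12 t ^+ 5)%:F).

(* Main.v *)
Require Import Defs.
From HB Require Import structures.
From mathcomp Require Import all_boot all_order all_algebra.
From mathcomp Require Import generic_quotient fraction.
From mathcomp Require Import reals complex.
From mathcomp Require Import ring zify.

(** Write phi = N / D with N = - c F^3 G and D = H^5, where F, G have degree 3,
    H has degree 2 and c is a constant.  Two polynomial identities carry the
    whole theorem:
      H^5 + c F^3 G = e P^2              (this is the formula for 1 - phi),
      (3 F' G + F G') H - 5 F G H' = 30 x P.
    The second one says that the Wronskian N' D - N D' is, up to a nonzero
    constant, x F^2 P H^4, that is, it locates all the ramification of phi: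
    in characteristic 0 the ramification order of phi at a finite point a is one
    more than the multiplicity of a in the Wronskian
    ([ram_order_wronskian]).

    No discriminant has to be computed.  Suppose that F G and H are coprime and
    that F, G, H, P do not vanish at 0.  At a root of F G the order
    3 mup F + mup G of phi exceeds by one the order 2 mup F of the Wronskian,
    hence mup F + mup G = 1: F and G are separable and have no common root.
    The same comparison reads 2 mup P = 1 + mup P at a root of P, and
    5 mup H = 1 + 4 mup H at a root of H ([mup_wronskian]).
    Hence F, G, P, H have 3, 3, 6, 2 simple roots, which gives the three fibers;
    the point at infinity is a pole of order 12 - 10 = 2; and the only
    remaining zero of the Wronskian is the simple zero x = 0.

    For F12, G12, H12, P12 both identities are checked by evaluation at an
    arbitrary point.  The coprimality of F12 G12 with H12 and the
    nonvanishing at 0 hold as soon as an explicit polynomial in t does not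
    vanish ([nondegenerate12]), which excludes finitely many t. *)

Set Implicit Arguments.
Unset Strict Implicit.
Unset Printing Implicit Defensive.

Import Order.TTheory GRing.Theory Num.Theory.
Local Open Scope ring_scope.

(** * Rational functions in lowest terms *)

Definition reduced (K : fieldType) (f : {fraction {poly K}}) (N D : {poly K}) :=
  [/\ D != 0, coprimep N D & f = N%:F / D%:F].

Lemma frac_repr (K : fieldType) (f : {fraction {poly K}}) :
  f = (\n_(repr f))%:F / (\d_(repr f))%:F.
Proof.
have d0 := denom_ratioP (repr f).
apply: (canRL (mulfK _)); first by rewrite tofrac_eq0.
rewrite -{1}[f]reprK; move: (repr f) d0 => r d0.
apply/eqP; rewrite !piE FracField.equivfE /FracField.mulf.
by rewrite !numden_Ratio ?mulr1 ?oner_eq0 // mulrC.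
Qed.

(** The numerator and denominator chosen in the definitions come from an
    arbitrary representative of the fraction; by Gauss's lemma they agree with
    any other coprime pair up to one common scalar, so that degree, values
    and orders may be computed from any such pair. *)
Lemma reduced_numden (K : fieldType) (f : {fraction {poly K}}) N D :
  reduced f N D ->
  exists2 k, k != 0 & rat_num f = k *: N /\ rat_den f = k *: D.
Proof.
case=> D0 cND fE; rewrite /rat_num /rat_den /=.
move: (frac_repr f) (denom_ratioP (repr f)).
move: (\n_(repr f)) (\d_(repr f)) => n d /=; rewrite fE => {fE f} fE d0.
have g0 : gcdp n d != 0 by rewrite gcdp_eq0 negb_and d0 orbT.
have : N * d = n * D.
  apply/eqP; rewrite -tofrac_eq !tofracM; apply/eqP.
  by move/eqP: fE; rewrite eqr_div ?tofrac_eq0 // => /eqP.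
have cab : coprimep (n %/ gcdp n d) (d %/ gcdp n d).
  by apply: coprimep_div_gcd; rewrite d0 orbT.
have := divpK (dvdp_gcdr n d); have := divpK (dvdp_gcdl n d).
move: (gcdp n d) g0 cab => g g0; move: (n %/ g) (d %/ g) => a b cab <- <-.
rewrite mulrA [a * g * D]mulrAC => /(mulIf g0) NbaD.
have /eqpP[[k1 k2] /= /andP[k10 k20] kbD] : b %= D.
  rewrite /eqp; apply/andP; split.
    by rewrite -(@Gauss_dvdpr _ D a) 1?coprimep_sym // -NbaD dvdp_mull.
  by rewrite -(@Gauss_dvdpr _ b N) 1?coprimep_sym // NbaD dvdp_mull.
have bD : b = (k2 / k1) *: D.
  by rewrite mulrC -scalerA -kbD scalerA mulVf // scale1r.
exists (k2 / k1); first by rewrite mulf_neq0 ?invr_eq0.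
split=> //; apply: (mulIf D0).
by rewrite -NbaD bD -scalerAr -scalerAl.
Qed.

Lemma reducedB (K : fieldType) (f : {fraction {poly K}}) N D c :
  reduced f N D -> reduced (f - (c%:P)%:F) (N - c *: D) D.
Proof.
case=> D0 cND ->; split=> //.
  rewrite coprimep_sym -mul_polyC -mulNr addrC.
  by rewrite coprimep_addl_mul coprimep_sym.
by rewrite -mul_polyC tofracB tofracM mulrBl mulfK ?tofrac_eq0.
Qed.

Lemma reducedV (K : fieldType) (f : {fraction {poly K}}) N D :
  N != 0 -> reduced f N D -> reduced f^-1 D N.
Proof. by move=> N0 [D0 cND ->]; split; rewrite 1?coprimep_sym // invf_div. Qed.

Lemma reduced_degree (K : fieldType) (f : {fraction {poly K}}) N D :
  reduced f N D -> rat_degree f = (maxn (size N) (size D)).-1.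
Proof.
by case/reduced_numden=> k k0 [nE dE]; rewrite /rat_degree nE dE !size_scale.
Qed.

Lemma reduced_eval (K : fieldType) (f : {fraction {poly K}}) N D a :
  reduced f N D ->
  rat_eval f (Some a) = if D.[a] == 0 then None else Some (N.[a] / D.[a]).
Proof.
case/reduced_numden=> k k0 [nE dE]; rewrite /= nE dE !hornerZ.
by rewrite mulf_eq0 (negPf k0) /= -mulf_div divff // mul1r.
Qed.

Lemma reduced_eval_pole_infty (K : fieldType) (f : {fraction {poly K}}) N D :
  reduced f N D -> (size D < size N)%N -> rat_eval f None = None.
Proof.
by case/reduced_numden=> k k0 [nE dE] ltDN /=; rewrite nE dE !size_scale ?ltDN.
Qed.

(** * Multiplicities and the Wronskian *)

Lemma mupZ (K : fieldType) (a k : K) (p : {poly K}) :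
  k != 0 -> mup a (k *: p) = mup a p.
Proof. by move=> k0; rewrite -mul_polyC mupMr // rootC. Qed.

Lemma mup_exp (K : fieldType) (a : K) n (p : {poly K}) :
  p != 0 -> mup a (p ^+ n) = (n * mup a p)%N.
Proof.
move=> p0; elim: n => [|n IHn]; first by rewrite expr0 mupNroot // root1.
by rewrite exprS mupM ?expf_neq0 // IHn mulSn.
Qed.

Lemma mup_polyX (K : fieldType) (a : K) : mup a 'X = (a == 0).
Proof.
have := mup_XsubCX 1 a 0; rewrite expr1 subr0 => ->.
by rewrite eq_sym; case: eqP.
Qed.

Lemma reduced_ord (K : fieldType) (f : {fraction {poly K}}) N D a :
  reduced f N D -> rat_ord f (Some a) = (mup a N)%:Z - (mup a D)%:Z.
Proof. by case/reduced_numden=> k k0 [nE dE]; rewrite /= nE dE !mupZ. Qed.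

Lemma reduced_ord_infty (K : fieldType) (f : {fraction {poly K}}) N D :
  reduced f N D -> rat_ord f None = (size D)%:Z - (size N)%:Z.
Proof. by case/reduced_numden=> k k0 [nE dE]; rewrite /= nE dE !size_scale. Qed.

(** Numerator of the derivative of N / D over D^2. *)
Definition wronskian (K : fieldType) (N D : {poly K}) :=
  N^`() * D - N * D^`().

Lemma wronskianC (K : fieldType) (N D : {poly K}) :
  wronskian D N = (-1) *: wronskian N D.
Proof. by rewrite /wronskian scaleN1r opprB; ring. Qed.

Lemma wronskian_subZ (K : fieldType) (N D : {poly K}) c :
  wronskian (N - c *: D) D = wronskian N D.
Proof.
rewrite /wronskian derivB derivZ -!mul_polyC; ring.
Qed.

(** If Q = (x - a)^m R with R(a) != 0, then Q' D has order exactly m - 1 at a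
    because m R(a) D(a) != 0 in K, while Q D' has order at least m. *)
Lemma mup_wronskian (K : fieldType) (Q D : {poly K}) a :
  [pchar K] =i pred0 -> Q != 0 -> root Q a -> ~~ root D a ->
  (mup a (wronskian Q D)).+1 = mup a Q.
Proof.
move=> /pcharf0P char0 Q0 Qa Da.
have [[|m] [R]] := multiplicity_XsubC Q a; rewrite Q0 /= => Ra QE.
  by move: Qa; rewrite QE expr0 mulr1 (negPf Ra).
pose B := ((m.+1)%:R *: R + ('X - a%:P) * R^`()) * D - ('X - a%:P) * R * D^`().
have Ba : ~~ root B a.
  rewrite /root /B !hornerE subrr !mul0r subr0 addr0.
  by rewrite !mulf_neq0 // char0.
have -> : wronskian Q D = B * ('X - a%:P) ^+ m.
  rewrite /wronskian QE derivM deriv_exp derivXsubC mul1r /B.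
  rewrite scaler_nat -mulr_natl.
  by rewrite exprS; ring.
by rewrite QE !mupMr // !mup_XsubCX eqxx.
Qed.

(** The Wronskian is unchanged, up to sign, when f is replaced by f - c or by
    1 / f.  One of these vanishes at a, its order there is the ramification
    order, and [mup_wronskian] applies to its numerator. *)
Lemma ram_order_wronskian (K : fieldType) (f : {fraction {poly K}}) N D a :
  [pchar K] =i pred0 -> reduced f N D -> wronskian N D != 0 ->
  ram_order f (Some a) = (mup a (wronskian N D)).+1.
Proof.
move=> char0 redf W0; have [D0 cND _] := redf.
have Wl0 (p : {poly K}) : p = 0 -> wronskian p D = 0.
  by move=> ->; rewrite /wronskian deriv0 !mul0r subrr.
rewrite /ram_order (reduced_eval a redf); case: ifPn => Da.
  have Na : ~~ root N a.
    by rewrite /root (coprimep_root (p := D)) // coprimep_sym.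
  have N0 : N != 0 by apply: contraNneq W0 => /Wl0 ->.
  rewrite (reduced_ord a (reducedV N0 redf)) (mupNroot Na) subr0 /=.
  by rewrite -(mup_wronskian (D := N)) // wronskianC mupZ // oppr_eq0 oner_eq0.
have redfc := reducedB (N.[a] / D.[a]) redf.
rewrite (reduced_ord a redfc) (mupNroot Da) subr0 /=.
rewrite -(mup_wronskian (D := D)) ?wronskian_subZ //.
  by apply: contraNneq W0 => /Wl0; rewrite wronskian_subZ => ->.
by rewrite /root !hornerE divfK // subrr.
Qed.

(** * Roots over an algebraically closed field *)

Lemma root_enumeration (K : closedFieldType) (p : {poly K}) :
  p != 0 -> exists2 s : seq K, size s = (size p).-1 &
     (forall a, (a \in s) = root p a) /\ (forall a, count_mem a s = mup a p).
Proof.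
move=> p0; have [s pE] := closed_field_poly_normal p.
have l0 : lead_coef p != 0 by rewrite lead_coef_eq0.
exists s; first by rewrite [in RHS]pE size_scale // size_prod_XsubC.
split=> a; first by rewrite pE rootZ // root_prod_XsubC.
by rewrite [in RHS]pE mupZ // mu_prod_XsubC.
Qed.

Lemma simple_roots (K : closedFieldType) (p : {poly K}) :
  p != 0 -> (forall a, root p a -> mup a p = 1%N) ->
  exists s : seq K,
    [/\ uniq s, size s = (size p).-1 & forall a, (a \in s) = root p a].
Proof.
move=> p0 mup1; have [s sz [rs cs]] := root_enumeration p0.
exists s; split=> //; apply: count_mem_uniq => a; rewrite cs rs.
by case: (boolP (root p a)) => [/mup1 -> //|/mupNroot ->].
Qed.

(** * The ramification pattern forced by the two identities *)

(** The hypotheses under which - c F^3 G / H^5 has the required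
    ramification.  Separability of F, G, H, P is a consequence. *)
Record certificate (K : fieldType) (F G H P : {poly K}) (c e m : K) : Prop :=
  Certificate {
    szF : size F = 4%N; szG : size G = 4%N;
    szH : size H = 3%N; szP : size P = 7%N;
    c_neq0 : c != 0; e_neq0 : e != 0; m_neq0 : m != 0;
    fibers_eq : H ^+ 5 + c *: (F ^+ 3 * G) = e *: P ^+ 2;
    wronskian_eq :
      (3 *: (F^`() * G) + F * G^`()) * H - 5 *: (F * G * H^`())
      = m *: ('X * P);
    coFG_H : coprimep (F * G) H;
    F_at0 : ~~ root F 0; G_at0 : ~~ root G 0;
    H_at0 : ~~ root H 0; P_at0 : ~~ root P 0 }.

Lemma map_constant (A : eqType) (B : Type) (g : A -> B) k s :
  {in s, forall x, g x = k} -> [seq g x | x <- s] = nseq (size s) k.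
Proof.
elim: s => //= x s IHs gk; rewrite gk ?mem_head // IHs // => y ys.
by rewrite gk // mem_behead.
Qed.

Section Ramification.
Variables (K : closedFieldType) (char0 : [pchar K] =i pred0).
Variables (F G H P : {poly K}) (c e m : K).
Hypothesis bd : certificate F G H P c e m.
Let N := (- c) *: (F ^+ 3 * G).
Let D := H ^+ 5.

Lemma cert_neq0 : [/\ F != 0, G != 0, H != 0 & P != 0].
Proof.
by case: bd => sF sG sH sP *; split; rewrite -size_poly_gt0 ?sF ?sG ?sH ?sP.
Qed.

Lemma cert_sizeN : size N = 13%N.
Proof.
have [F0 G0 _ _] := cert_neq0; case: bd => sF sG _ _ c0 *.
rewrite size_scale ?oppr_eq0 // size_mul ?expf_neq0 // sG.
by rewrite [size _]polySpred ?expf_neq0 // size_exp sF.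
Qed.

Lemma cert_sizeD : size D = 11%N.
Proof.
have [_ _ H0 _] := cert_neq0; case: bd => _ _ sH *.
by rewrite [size _]polySpred ?expf_neq0 // size_exp sH.
Qed.

Lemma cert_rootN a : root N a = root F a || root G a.
Proof.
rewrite rootZ ?oppr_eq0 ?(c_neq0 bd) // rootM.
by rewrite rootE horner_exp expf_eq0.
Qed.

Lemma cert_rootD a : root D a = root H a.
Proof. by rewrite rootE horner_exp expf_eq0. Qed.

Lemma cert_sub1 : N - 1 *: D = (- e) *: P ^+ 2.
Proof. by rewrite scale1r /N !scaleNr -(fibers_eq bd) opprD addrC. Qed.

Lemma cert_rootP a : root P a = (D.[a] == N.[a]).
Proof.
rewrite eq_sym -subr_eq0 -[D]scale1r -hornerN -hornerD cert_sub1.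
by rewrite hornerZ mulf_eq0 oppr_eq0 (negPf (e_neq0 bd)) horner_exp expf_eq0.
Qed.

Lemma cert_reduced (f : {fraction {poly K}}) : f = N%:F / D%:F -> reduced f N D.
Proof.
have [F0 G0 H0 P0] := cert_neq0.
move=> fE; split=> //; first by rewrite expf_neq0.
rewrite coprimepZl ?oppr_eq0 ?(c_neq0 bd) // coprimep_expr //.
have := coFG_H bd; rewrite !coprimepMl => /andP[cF ->].
by rewrite !cF.
Qed.

(** The derivatives of F^3 G and H^5 contribute a factor F^2 H^4; the
    cofactor is the left-hand side of [wronskian_eq]. *)
Lemma cert_wronskian : wronskian N D = (- c * m) *: ('X * F ^+ 2 * P * H ^+ 4).
Proof.
have <- : (- c)%:P * (F ^+ 2 * H ^+ 4 * (m *: ('X * P)))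
        = (- c * m) *: ('X * F ^+ 2 * P * H ^+ 4).
  by rewrite -!mul_polyC polyCM; ring.
rewrite -(wronskian_eq bd) /wronskian /N /D.
rewrite derivZ derivM !deriv_exp -!mul_polyC !polyC_natr.
by rewrite /=; ring.
Qed.

Lemma cert_wronskian_neq0 : wronskian N D != 0.
Proof.
have [F0 G0 H0 P0] := cert_neq0.
rewrite cert_wronskian scaler_eq0 negb_or.
rewrite mulf_neq0 ?oppr_eq0 ?(c_neq0 bd) ?(m_neq0 bd) //=.
by rewrite !mulf_neq0 ?expf_neq0 ?polyX_eq0.
Qed.

Lemma cert_mupW a :
  mup a (wronskian N D) = ((a == 0%R) + 2 * mup a F + mup a P + 4 * mup a H)%N.
Proof.
have [F0 G0 H0 P0] := cert_neq0; case: bd => sF sG sH sP c0 e0 m0 *.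
rewrite cert_wronskian mupZ ?mulf_neq0 ?oppr_eq0 //.
by rewrite 3?mupM ?mulf_neq0 ?expf_neq0 ?polyX_eq0 // mup_polyX !mup_exp.
Qed.

Lemma cert_FG_notH a : root F a || root G a -> ~~ root H a.
Proof. by rewrite -rootM => /(coprimep_root (coFG_H bd)). Qed.

(** At a common root of P and H the first identity would make F^3 G vanish,
    against coprimality with H. *)
Lemma cert_P_notH a : root P a -> ~~ root H a.
Proof.
rewrite cert_rootP => /eqP DN; apply/negP => Ha.
have: root N a by rewrite rootE -DN -rootE cert_rootD.
by rewrite cert_rootN => /cert_FG_notH; rewrite Ha.
Qed.

Lemma cert_P_notFG a : root P a -> ~~ (root F a || root G a).
Proof.
move=> Pa; have Ha := cert_P_notH Pa; apply: contra Ha; rewrite -cert_rootN.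
by rewrite -cert_rootD rootE; move: Pa; rewrite cert_rootP => /eqP <-.
Qed.

Lemma cert_root_neq0 a : [|| root F a, root G a, root P a | root H a] -> a != 0.
Proof.
by case: bd => ? ? ? ? ? ? ? ? ? ? F0 G0 H0 P0; apply: contraL => /eqP ->;
   rewrite !negb_or F0 G0 P0 H0.
Qed.

(** N has order 3 mup F + mup G at a, one more than the order 2 mup F of the
    Wronskian. *)
Lemma cert_mupFG a : root F a || root G a -> (mup a F + mup a G = 1)%N.
Proof.
move=> FGa; have [F0 G0 _ _] := cert_neq0.
have Ha := cert_FG_notH FGa.
have Pa : ~~ root P a by apply: contraL FGa; apply: cert_P_notFG.
have a0 : a != 0 by apply: cert_root_neq0; rewrite orbA FGa.
have Na : root N a by rewrite cert_rootN.
have N0 : N != 0 by rewrite -size_poly_gt0 cert_sizeN.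
have := mup_wronskian (D := D) char0 N0 Na; rewrite cert_rootD => /(_ Ha).
rewrite cert_mupW (negPf a0) (mupNroot Pa) (mupNroot Ha) /N mupZ; last first.
  by rewrite oppr_eq0 (c_neq0 bd).
by rewrite mupM ?expf_neq0 // mup_exp //; lia.
Qed.

(** N - D is a constant times P^2 and has the same Wronskian with D as N;
    so 2 mup P = 1 + mup P. *)
Lemma cert_mupP a : root P a -> mup a P = 1%N.
Proof.
move=> Pa; have [_ _ _ P0] := cert_neq0.
have Ha := cert_P_notH Pa.
have /norP[Fa _] := cert_P_notFG Pa.
have a0 : a != 0 by apply: cert_root_neq0; rewrite Pa !orbT.
have ND0 : N - 1 *: D != 0.
  by rewrite cert_sub1 scaler_eq0 oppr_eq0 (negPf (e_neq0 bd)) expf_eq0.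
have := mup_wronskian (D := D) char0 ND0; rewrite wronskian_subZ cert_sub1.
move=> /(_ a); rewrite cert_rootD rootZ ?oppr_eq0 ?(e_neq0 bd) //.
rewrite mupZ ?oppr_eq0 ?(e_neq0 bd) // mup_exp // [root (_ ^+ _) _]rootE.
rewrite horner_exp expf_eq0 /= => /(_ Pa Ha).
by rewrite cert_mupW (negPf a0) (mupNroot Fa) (mupNroot Ha); lia.
Qed.

(** Here 1 / phi vanishes, and the comparison reads 5 mup H = 1 + 4 mup H. *)
Lemma cert_mupH a : root H a -> mup a H = 1%N.
Proof.
move=> Ha; have [_ _ H0 _] := cert_neq0.
have /norP[Fa Ga] : ~~ (root F a || root G a).
  by apply: contraL Ha; apply: cert_FG_notH.
have Pa : ~~ root P a by apply: contraL Ha; apply: cert_P_notH.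
have a0 : a != 0 by apply: cert_root_neq0; rewrite Ha !orbT.
have := mup_wronskian (D := N) char0 (expf_neq0 5 H0).
move=> /(_ a); rewrite -/D cert_rootD cert_rootN wronskianC.
rewrite mupZ ?oppr_eq0 ?oner_eq0 // mup_exp // (negPf Fa) (negPf Ga).
move=> /(_ Ha isT).
by rewrite cert_mupW (negPf a0) (mupNroot Fa) (mupNroot Pa); lia.
Qed.

Variable f : {fraction {poly K}}.
Hypothesis fE : f = N%:F / D%:F.

Lemma cert_eval0 p :
  (rat_eval f p == Some 0)
  = if p is Some a then root F a || root G a else false.
Proof.
case: p => [a|]; last first.
  rewrite (reduced_eval_pole_infty (cert_reduced fE)) //.
  by rewrite cert_sizeN cert_sizeD.
rewrite (reduced_eval a (cert_reduced fE)) -rootE cert_rootD.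
case: ifPn => Ha; first by apply/esym; apply: contraTF Ha => /cert_FG_notH.
rewrite -cert_rootN (inj_eq (@Some_inj _)) mulf_eq0 invr_eq0 -!rootE cert_rootD.
by rewrite (negPf Ha) orbF.
Qed.

Lemma cert_eval1 p :
  (rat_eval f p == Some 1) = if p is Some a then root P a else false.
Proof.
case: p => [a|]; last first.
  rewrite (reduced_eval_pole_infty (cert_reduced fE)) //.
  by rewrite cert_sizeN cert_sizeD.
rewrite (reduced_eval a (cert_reduced fE)) -rootE cert_rootD.
case: ifPn => Ha; first by apply/esym; apply: contraTF Ha => /cert_P_notH.
have Da : D.[a] != 0 by rewrite -rootE cert_rootD.
rewrite (inj_eq (@Some_inj _)) cert_rootP -(inj_eq (mulIf Da)).
by rewrite divfK // mul1r eq_sym.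
Qed.

Lemma cert_eval_infty p :
  (rat_eval f p == None) = if p is Some a then root H a else true.
Proof.
case: p => [a|]; last first.
  rewrite (reduced_eval_pole_infty (cert_reduced fE)) //.
  by rewrite cert_sizeN cert_sizeD.
by rewrite (reduced_eval a (cert_reduced fE)) -rootE cert_rootD; case: ifP.
Qed.

Lemma cert_ram a : ram_order f (Some a) =
  ((a == 0%R) + 2 * mup a F + mup a P + 4 * mup a H).+1%N.
Proof.
rewrite (ram_order_wronskian a char0 (cert_reduced fE)) ?cert_mupW //.
exact: cert_wronskian_neq0.
Qed.

Lemma cert_ram_infty : ram_order f None = 2%N.
Proof.
have N0 : N != 0 by rewrite -size_poly_gt0 cert_sizeN.
rewrite /ram_order (eqP (_ : rat_eval f None == None)) ?cert_eval_infty //.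
rewrite (reduced_ord_infty (reducedV N0 (cert_reduced fE))).
by rewrite cert_sizeN cert_sizeD.
Qed.

(** In the Wronskian x F^2 P H^4 only the factor x contributes a zero that does
    not lie above 0, 1 or infinity. *)
Lemma cert_extra : extra_ram_point f (Some 0).
Proof.
case: bd => ? ? ? ? ? ? ? ? ? ? F0 G0 H0 P0; split.
- rewrite !inE cert_eval0 cert_eval1 cert_eval_infty.
  by rewrite (negPf F0) (negPf G0) (negPf H0) (negPf P0).
- by rewrite cert_ram eqxx !mupNroot.
- move=> [a|] ram_gt1 a0; rewrite !inE cert_eval0 cert_eval1 cert_eval_infty //.
  move: ram_gt1; apply: contraTT; rewrite !negb_or -!andbA.
  case/and4P=> Fa Ga Pa Ha; rewrite cert_ram !mupNroot //.
  by move: a0; rewrite (inj_eq (@Some_inj _)) => /negPf ->.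
Qed.

Lemma cert_fiber0 : fiber_pattern f (Some 0) [:: 3; 3; 3; 1; 1; 1]%N.
Proof.
have [F0 G0 _ _] := cert_neq0.
have [|rF [uF zF inF]] := simple_roots F0.
  move=> a Fa; have := cert_mupFG (introT orP (or_introl Fa)).
  by have := XsubC_dvd a F0; rewrite dvdp_XsubCl Fa; lia.
have [|rG [uG zG inG]] := simple_roots G0.
  move=> a Ga; have := cert_mupFG (introT orP (or_intror Ga)).
  by have := XsubC_dvd a G0; rewrite dvdp_XsubCl Ga; lia.
have FNG a : root G a -> ~~ root F a.
  move=> Ga; have := cert_mupFG (introT orP (or_intror Ga)).
  have := XsubC_dvd a G0; have := XsubC_dvd a F0; rewrite !dvdp_XsubCl Ga.
  by case: (root F a) => //; lia.
have ram_at a :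
    root F a || root G a -> ram_order f (Some a) = (2 * mup a F).+1%N.
  move=> FGa; rewrite cert_ram (mupNroot (cert_FG_notH FGa)).
  rewrite (mupNroot (contraL (@cert_P_notFG a) FGa)).
  have /negPf -> : a != 0 by apply: cert_root_neq0; rewrite orbA FGa.
  by rewrite muln0 !addn0.
exists [seq Some a | a <- rF ++ rG]; split.
- rewrite map_inj_uniq; last exact: Some_inj.
  rewrite cat_uniq uF uG andbT /=; apply/hasPn => a.
  by rewrite inG inF; apply: FNG.
- move=> [a|]; rewrite cert_eval0; last by apply/mapP => -[].
  by rewrite (mem_map (@Some_inj _)) mem_cat inF inG.
- rewrite -map_comp map_cat.
  rewrite (@map_constant _ _ _ 3%N rF) ?(@map_constant _ _ _ 1%N rG);
    rewrite ?zF ?zG ?(szF bd) ?(szG bd) //.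
    move=> a; rewrite inG => Ga.
    by rewrite /= ram_at ?Ga ?orbT // mupNroot // FNG.
  move=> a; rewrite inF => Fa; rewrite /= ram_at ?Fa //.
  have := cert_mupFG (introT orP (or_introl Fa)).
  by have := XsubC_dvd a F0; rewrite dvdp_XsubCl Fa; lia.
Qed.

Lemma cert_fiber1 : fiber_pattern f (Some 1) [:: 2; 2; 2; 2; 2; 2]%N.
Proof.
have [_ _ _ P0] := cert_neq0.
have [r [ur zr inr]] := simple_roots P0 cert_mupP.
exists [seq Some a | a <- r]; split.
- by rewrite map_inj_uniq //; apply: Some_inj.
- move=> [a|]; rewrite cert_eval1; last by apply/mapP => -[].
  by rewrite (mem_map (@Some_inj _)) inr.
- rewrite -map_comp (@map_constant _ _ _ 2%N) ?zr ?(szP bd) //.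
  move=> a; rewrite inr => Pa.
  have /norP[Fa _] := cert_P_notFG Pa.
  rewrite /= cert_ram (cert_mupP Pa) (mupNroot Fa) (mupNroot (cert_P_notH Pa)).
  by have /negPf -> : a != 0 by apply: cert_root_neq0; rewrite Pa !orbT.
Qed.

Lemma cert_fiber_infty : fiber_pattern f None [:: 5; 5; 2]%N.
Proof.
have [_ _ H0 _] := cert_neq0.
have [r [ur zr inr]] := simple_roots H0 cert_mupH.
exists (rcons [seq Some a | a <- r] None); split.
- rewrite rcons_uniq map_inj_uniq ?ur ?andbT; last exact: Some_inj.
  by apply/mapP => -[].
- move=> [a|]; rewrite cert_eval_infty mem_rcons inE //.
  by rewrite (mem_map (@Some_inj _)) inr.
- rewrite map_rcons -map_comp (@map_constant _ _ _ 5%N);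
    rewrite ?zr ?(szH bd) ?cert_ram_infty //.
  move=> a; rewrite inr => Ha.
  have /norP[Fa _] := contraL (@cert_FG_notH a) Ha.
  rewrite /= cert_ram (cert_mupH Ha) (mupNroot Fa).
  rewrite (mupNroot (contraL (@cert_P_notH a) Ha)).
  by have /negPf -> : a != 0 by apply: cert_root_neq0; rewrite Ha !orbT.
Qed.

Theorem cert_ramification :
  [/\ almost_belyi_R4 f 12
           [:: 3; 3; 3; 1; 1; 1]%N [:: 2; 2; 2; 2; 2; 2]%N [:: 5; 5; 2]%N,
         rat_eval f None = None,
         ram_order f None = 2%N
       & extra_ram_point f (Some 0)].
Proof.
have deg : rat_degree f = 12%N.
  by rewrite (reduced_degree (cert_reduced fE)) cert_sizeN cert_sizeD.
have eval_infty : rat_eval f None = None by apply/eqP; rewrite cert_eval_infty.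
split=> //; [ | exact: cert_ram_infty | exact: cert_extra].
split=> //; first by split; [rewrite deg | exists (Some 0); apply: cert_extra].
by split; [apply: cert_fiber0 | apply: cert_fiber1 | apply: cert_fiber_infty].
Qed.
End Ramification.

(** * The identities for the polynomials of degree 12 *)

(** Reduces a polynomial identity to a scalar one; characteristic 0 provides
    infinitely many points. *)
Lemma poly_ext (K : fieldType) (p q : {poly K}) :
  [pchar K] =i pred0 -> (forall x, p.[x] = q.[x]) -> p = q.
Proof.
move=> char0 pq; apply/eqP; rewrite -subr_eq0; apply/eqP.
apply: (@roots_geq_poly_eq0 _ _ [seq i%:R | i <- iota 0 (size (p - q))]).
- by apply/allP => _ /mapP[i _ ->]; rewrite rootE hornerD hornerN pq subrr.
- rewrite map_inj_uniq ?iota_uniq // => m n /eqP mn.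
  have le_nat i j : i%:R == j%:R :> K -> (i <= j)%N.
    have /orP[//|le_ji] := leq_total i j; rewrite -subr_eq0 -natrB //.
    by move/pcharf0P: char0 => ->; rewrite subn_eq0.
  by apply/eqP; rewrite eqn_leq !le_nat // eq_sym.
- by rewrite size_map size_iota.
Qed.

Definition horner12E :=
  (hornerD, hornerN, hornerZ, hornerC, hornerXn, hornerX).

Lemma P12_sqr (K : fieldType) (t : K) : [pchar K] =i pred0 ->
  P12 t ^+ 2 = (16 * (3 * t + 4) ^+ 7) *: H12 t ^+ 5
    + (t ^+ 2 * (10 * t ^+ 2 + 25 * t + 16)) *: (F12 t ^+ 3 * G12 t).
Proof.
move=> char0; apply: poly_ext => // x.
rewrite hornerD !hornerZ !horner_exp hornerM horner_exp.
by rewrite /P12 /H12 /F12 /G12 !horner12E; ring.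
Qed.

Lemma deriv_F12 (K : fieldType) (t x : K) : (F12 t)^`().[x] =
  6 * t * x ^+ 2 + 28 * t * x - 2 * (2 * t + 5) * (15 * t ^+ 2 + 25 * t + 16).
Proof.
rewrite /F12 !(derivD, derivN, derivZ, derivXn, derivX, derivC).
by rewrite !(horner12E, hornerMn) /= ?horner12E; ring.
Qed.

Lemma deriv_G12 (K : fieldType) (t x : K) : (G12 t)^`().[x] =
  150 * t * (10 * t ^+ 2 + 25 * t + 16) * x ^+ 2
  - 60 * t * (14 * t ^+ 3 - 18 * t ^+ 2 - 105 * t - 80) * x
  - 6 * (5 * t + 16) * (2 * t + 1) * (20 * t ^+ 3 + 35 * t ^+ 2 + 3 * t - 16).
Proof.
rewrite /G12 !(derivD, derivN, derivZ, derivXn, derivX, derivC).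
by rewrite !(horner12E, hornerMn) /= ?horner12E; ring.
Qed.

Lemma deriv_H12 (K : fieldType) (t x : K) :
  (H12 t)^`().[x] = 6 * t * x + 12 * t.
Proof.
rewrite /H12 !(derivD, derivN, derivZ, derivXn, derivX, derivC).
by rewrite !(horner12E, hornerMn) /= ?horner12E; ring.
Qed.

Lemma wronskian12 (K : fieldType) (t : K) : [pchar K] =i pred0 ->
  (3 *: ((F12 t)^`() * G12 t) + F12 t * (G12 t)^`()) * H12 t
    - 5 *: (F12 t * G12 t * (H12 t)^`()) = 30 *: ('X * P12 t).
Proof.
move=> char0; apply: poly_ext => // x.
rewrite hornerD hornerN hornerM hornerD !hornerZ !hornerM.
rewrite deriv_F12 deriv_G12 deriv_H12 hornerX.
by rewrite /P12 /H12 /F12 /G12 !horner12E; ring.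
Qed.

(** Modulo H12, the polynomial 3 F12 is - (10 t^2 + 25 t + 16) (u x + v),
    with u, v in K[t].  The resultant of u x + v and H12 is
    (3 t + 4)^3 (5 t + 16)^2. *)
Lemma coprime_F12_H12 (K : closedFieldType) (t : K) :
  10 * t ^+ 2 + 25 * t + 16 != 0 -> 3 * t + 4 != 0 -> 5 * t + 16 != 0 ->
  coprimep (F12 t) (H12 t).
Proof.
move=> k0 a0 b0; apply: Pdiv.ClosedField.root_coprimep => x.
rewrite rootE => /eqP Fx.
apply/eqP => Hx.
pose u := 18 * t + 32; pose v := 3 * (5 * t + 16) * (t + 2).
have uv0 : u * x + v = 0.
  apply: (mulfI k0); rewrite mulr0.
  transitivity ((2 * x + 6) * (H12 t).[x] - 3 * (F12 t).[x]).
    by rewrite /F12 /H12 !horner12E /u /v; ring.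
  by rewrite Fx Hx !mulr0 subrr.
have : (3 * t + 4) ^+ 3 * (5 * t + 16) ^+ 2 != 0.
  by rewrite mulf_neq0 ?expf_neq0.
apply/negP; rewrite negbK; apply/eqP.
(* The resultant as a combination of H12 and u x + v. *)
transitivity (u ^+ 2 * (H12 t).[x]
  - (u * x + v) * (3 * t * (u * x - v) + 12 * t * u)).
  by rewrite /H12 !horner12E /u /v; ring.
by rewrite Hx uv0 mulr0 mul0r subrr.
Qed.

(** The same reduction; the resultant is now
    (3 t + 4)^3 (2 t + 1)^2 (5 t + 16)^4. *)
Lemma coprime_G12_H12 (K : closedFieldType) (t : K) :
  10 * t ^+ 2 + 25 * t + 16 != 0 -> 3 * t + 4 != 0 -> 5 * t + 16 != 0 ->
  2 * t + 1 != 0 -> coprimep (G12 t) (H12 t).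
Proof.
move=> k0 a0 b0 c0; apply: Pdiv.ClosedField.root_coprimep => x.
rewrite rootE => /eqP Gx.
apply/eqP => Hx.
pose u := 360 * t ^+ 3 + 1058 * t ^+ 2 + 1088 * t + 512.
pose v := (2 * t + 1) * (5 * t + 16) * (15 * t ^+ 2 + 6 * t - 32).
have uv0 : u * x + v = 0.
  apply: (mulfI k0); rewrite mulr0.
  transitivity (((500 * t ^+ 2 + 1250 * t + 800) * x
      - (420 * t ^+ 3 + 1460 * t ^+ 2 + 1850 * t + 800)) * (H12 t).[x]
      - 3 * (G12 t).[x]).
    by rewrite /G12 /H12 !horner12E /u /v; ring.
  by rewrite Gx Hx !mulr0 subrr.
have : (3 * t + 4) ^+ 3 * (2 * t + 1) ^+ 2 * (5 * t + 16) ^+ 4 != 0.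
  by rewrite !mulf_neq0 ?expf_neq0.
apply/negP; rewrite negbK; apply/eqP.
(* The resultant as a combination of H12 and u x + v. *)
transitivity (u ^+ 2 * (H12 t).[x]
  - (u * x + v) * (3 * t * (u * x - v) + 12 * t * u)).
  by rewrite /H12 !horner12E /u /v; ring.
by rewrite Hx uv0 mulr0 mul0r subrr.
Qed.

Lemma size_addl (K : nzRingType) n (p q : {poly K}) :
  size p = n.+1 -> (size q <= n)%N -> size (p + q) = n.+1.
Proof. by move=> sp sq; rewrite size_polyDl sp. Qed.

Lemma size_scale_Xn_leq (K : nzRingType) (a : K) n :
  (size (a *: 'X^n) <= n.+1)%N.
Proof. by rewrite (leq_trans (size_scale_leq _ _)) // size_polyXn. Qed.

Lemma size_scale_X_leq (K : nzRingType) (a : K) : (size (a *: 'X) <= 2)%N.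
Proof. by rewrite (leq_trans (size_scale_leq _ _)) // size_polyX. Qed.

(** Reduces the size of a sum of terms of decreasing degree to that of the first
    term. *)
Ltac drop_lower_terms :=
  do ![apply: size_addl; last by
    rewrite ?size_polyN;
    (exact: leq_trans (size_scale_Xn_leq _ _) _
     || exact: leq_trans (size_scale_X_leq _) _
     || exact: leq_trans (size_polyC_leq1 _) _)].

Lemma size_F12 (K : numFieldType) (t : K) : t != 0 -> size (F12 t) = 4%N.
Proof.
move=> t0; rewrite /F12; drop_lower_terms.
by rewrite size_scale ?size_polyXn // mulf_neq0 // pnatr_eq0.
Qed.

Lemma size_G12 (K : numFieldType) (t : K) :
  t != 0 -> 10 * t ^+ 2 + 25 * t + 16 != 0 -> size (G12 t) = 4%N.
Proof.
move=> t0 k0; rewrite /G12; drop_lower_terms.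
by rewrite size_scale ?size_polyXn // !mulf_neq0 // pnatr_eq0.
Qed.

Lemma size_H12 (K : numFieldType) (t : K) : t != 0 -> size (H12 t) = 3%N.
Proof.
move=> t0; rewrite /H12; drop_lower_terms.
by rewrite size_scale ?size_polyXn // mulf_neq0 // pnatr_eq0.
Qed.

Lemma size_P12 (K : numFieldType) (t : K) :
  t != 0 -> 10 * t ^+ 2 + 25 * t + 16 != 0 -> size (P12 t) = 7%N.
Proof.
move=> t0 k0; rewrite /P12; drop_lower_terms.
by rewrite size_scale ?size_polyXn // !mulf_neq0 ?expf_neq0 // pnatr_eq0.
Qed.

(** When t = 0 this polynomial is the constant 16. *)
Lemma H12_neq0 (K : numFieldType) (t : K) : H12 t != 0.
Proof.
have [t0|t0] := eqVneq t 0; last by rewrite -size_poly_gt0 size_H12.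
have: (H12 t).[0] != 0.
  by rewrite /H12 !horner12E t0 !mulr0 !mul0r !add0r mul1r pnatr_eq0.
by apply: contraNneq => ->; rewrite horner0.
Qed.

Lemma fibers12 (K : numFieldType) (t : K) : 3 * t + 4 != 0 ->
  H12 t ^+ 5
    + (t ^+ 2 * (10 * t ^+ 2 + 25 * t + 16) / (16 * (3 * t + 4) ^+ 7))
      *: (F12 t ^+ 3 * G12 t)
  = (1 / (16 * (3 * t + 4) ^+ 7)) *: P12 t ^+ 2.
Proof.
move=> a0; have d0 : 16 * (3 * t + 4) ^+ 7 != 0.
  by rewrite mulf_neq0 ?expf_neq0 // pnatr_eq0.
rewrite (P12_sqr t (@pchar_num _)) scalerDr !scalerA div1r mulVf //.
by rewrite scale1r [_^-1 * _]mulrC.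
Qed.

Lemma phi12E (K : fieldType) (t : K) :
  phi12 t =
    ((- (t ^+ 2 * (10 * t ^+ 2 + 25 * t + 16) / (16 * (3 * t + 4) ^+ 7)))
       *: (F12 t ^+ 3 * G12 t))%:F / (H12 t ^+ 5)%:F.
Proof.
by rewrite /phi12 mulrA -tofracN -tofracM -polyCN mul_polyC.
Qed.

Lemma one_sub_phi12 (K : numFieldType) (t : K) : 3 * t + 4 != 0 ->
  1 - phi12 t
  = ((1 / (16 * (3 * t + 4) ^+ 7))%:P)%:F
    * ((P12 t ^+ 2)%:F / (H12 t ^+ 5)%:F).
Proof.
move=> a0; have D0 : (H12 t ^+ 5)%:F != 0.
  by rewrite tofrac_eq0 expf_neq0 ?H12_neq0.
rewrite mulrA -tofracM mul_polyC -fibers12 // phi12E scaleNr tofracN tofracD.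
by rewrite mulNr opprK [RHS]mulrDl divff.
Qed.

(** * Generic parameters *)

(** The factors t and 10 t^2 + 25 t + 16 control the degrees, 3 t + 4 the
    denominator of phi12 and, with 5 t + 16 and 2 t + 1, the resultants; the
    other factors come from the values of F12, G12 and P12 at 0. *)
Definition nondegenerate12 (K : fieldType) (t : K) :=
  t * (10 * t ^+ 2 + 25 * t + 16) * (3 * t + 4) * (2 * t + 1) * (5 * t + 16)
    * (2 * t + 5) * (5 * t ^+ 2 + 10 * t + 6)
    * (100 * t ^+ 7 + 740 * t ^+ 6 + 2289 * t ^+ 5 + 3780 * t ^+ 4
        + 3600 * t ^+ 3 + 2040 * t ^+ 2 + 700 * t + 128) != 0.

Lemma P12_at0 (K : fieldType) (t : K) : (P12 t).[0] =
  - ((2 * t + 1) * (5 * t + 16) ^+ 3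
     * (100 * t ^+ 7 + 740 * t ^+ 6 + 2289 * t ^+ 5 + 3780 * t ^+ 4
        + 3600 * t ^+ 3 + 2040 * t ^+ 2 + 700 * t + 128)).
Proof. by rewrite /P12 !horner12E; ring. Qed.

Lemma certificate12 (K : numClosedFieldType) (t : K) : nondegenerate12 t ->
  certificate (F12 t) (G12 t) (H12 t) (P12 t)
    (t ^+ 2 * (10 * t ^+ 2 + 25 * t + 16) / (16 * (3 * t + 4) ^+ 7))
    (1 / (16 * (3 * t + 4) ^+ 7)) 30.
Proof.
rewrite /nondegenerate12 !mulf_eq0 !negb_or -!andbA.
case/andP=> t0 /and5P[k0 a0 b0 c0 /and3P[d0 e0 o0]].
have q0 : 16 * (3 * t + 4) ^+ 7 != 0.
  by rewrite mulf_neq0 ?expf_neq0 // pnatr_eq0.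
split.
- exact: size_F12.
- exact: size_G12.
- exact: size_H12.
- exact: size_P12.
- by rewrite !mulf_neq0 ?expf_neq0 ?invr_eq0.
- by rewrite div1r invr_eq0.
- by rewrite pnatr_eq0.
- exact: fibers12.
- exact/wronskian12/pchar_num.
- by rewrite coprimepMl coprime_F12_H12 // coprime_G12_H12.
- rewrite rootE /F12 !horner12E !expr0n !(mulr0, oppr0, add0r) oppr_eq0.
  by rewrite !mulf_neq0.
- rewrite rootE /G12 !horner12E !expr0n !(mulr0, oppr0, add0r) oppr_eq0.
  by rewrite !mulf_neq0 ?expf_neq0.
- by rewrite rootE /H12 !horner12E !expr0n !mulr0 !add0r mulf_neq0.
- by rewrite rootE P12_at0 oppr_eq0 !mulf_neq0 ?expf_neq0.
Qed.

Lemma sizeS_neq0 (K : nzRingType) n (p : {poly K}) : size p = n.+1 -> p != 0.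
Proof. by move=> sp; rewrite -size_poly_gt0 sp. Qed.

Ltac nonzero_of_degree n :=
  apply: (@sizeS_neq0 _ n);
  drop_lower_terms; rewrite size_scale ?size_polyXn ?size_polyX // pnatr_eq0.

Lemma nondegenerate12_cofinite (K : numClosedFieldType) :
  exists S : seq K, forall t, t \notin S -> nondegenerate12 t.
Proof.
pose B : {poly K} := 'X * (10 *: 'X^2 + 25 *: 'X + 16%:P) * (3 *: 'X + 4%:P)
  * (2 *: 'X + 1%:P) * (5 *: 'X + 16%:P) * (2 *: 'X + 5%:P)
  * (5 *: 'X^2 + 10 *: 'X + 6%:P)
  * (100 *: 'X^7 + 740 *: 'X^6 + 2289 *: 'X^5 + 3780 *: 'X^4
        + 3600 *: 'X^3 + 2040 *: 'X^2 + 700 *: 'X + 128%:P).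
have BE t : nondegenerate12 t = ~~ root B t.
  by rewrite rootE /B !(hornerM, horner12E).
have B0 : B != 0.
  apply: mulf_neq0; last by nonzero_of_degree 7%N.
  apply: mulf_neq0; last by nonzero_of_degree 2%N.
  do 4![apply: mulf_neq0; last by nonzero_of_degree 1%N].
  by apply: mulf_neq0; [rewrite polyX_eq0 | nonzero_of_degree 2%N].
have [S _ [inS _]] := root_enumeration B0.
by exists S => t; rewrite inS BE.
Qed.

(** * The covering *)

Theorem mainTheorem1 (R : realType) :
  (forall t : R[i], 3 * t + 4 != 0 ->
     1 - phi12 t
     = ((1 / (16 * (3 * t + 4) ^+ 7))%:P)%:F
       * ((P12 t ^+ 2)%:F / (H12 t ^+ 5)%:F))
  /\
  (exists S : seq R[i], forall t : R[i], t \notin S ->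
     [/\ almost_belyi_R4 (phi12 t) 12
           [:: 3; 3; 3; 1; 1; 1]%N [:: 2; 2; 2; 2; 2; 2]%N [:: 5; 5; 2]%N,
         rat_eval (phi12 t) None = None,
         ram_order (phi12 t) None = 2%N
       & extra_ram_point (phi12 t) (Some 0)]).
Proof.
split; first by move=> t; apply: one_sub_phi12.
have [S nondegS] := nondegenerate12_cofinite R[i].
exists S => t /nondegS /certificate12 bd.
exact: (cert_ramification (@pchar_num _) bd (phi12E t)).
Qed.
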